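(* Let $L^*$ be a real symmetric positive definite $N\times N$ matrix and let $L$ be a real symmetric positive definite matrix that is a critical point of the expected log-likelihood $\Phi_{L^*}$. Let $K^*=L^*(I+L^* )^{-1}$ and $K=L(I+L)^{-1}$. Then $K^*$ and $K$ have the same diagonal.
   Context: For a matrix $A$ and $J\subset[N]=\{1,\dots,N\}$, $A_J$ is the principal submatrix indexed by $J$, with $\det A_\emptyset=1$. For a real symmetric positive definite $N\times N$ matrix $L$ and $J\subset[N]$, $p_J(L)=\det(L_J)/\det(I+L)$. The expected log-likelihood is the function on the open set of positive definite matrices (inside the space $\mathcal S_{[N]}$ of real symmetric $N\times N$ matrices) given by $\Phi_{L^*}(L)=\sum_{J\subset[N]}p_J(L^* )\log\det(L_J)-\log\det(I+L)$. A critical point is a positive definite $L$ at which the first derivative $\mathrm{d}\Phi_{L^*}(L)$ vanishes on $\mathcal S_{[N]}$. *)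

(* Defs.v *)
From HB Require Import structures.
From mathcomp Require Import all_boot all_order all_algebra.
From mathcomp Require Import all_classical all_reals all_analysis.

Set Implicit Arguments.
Unset Strict Implicit.
Unset Printing Implicit Defensive.

Import Order.TTheory GRing.Theory Num.Theory.
Import numFieldNormedType.Exports.

Local Open Scope ring_scope.

Lemma symmetricmxE (R : realType) (N : nat) (A : 'M[R]_N) :
  (A \is symmetricmx) = (A^T == A).
Proof.
rewrite is_hermitianmxE /= expr0 scale1r eq_sym; congr (_ == _).
by apply/matrixP => i j; rewrite !mxE.
Qed.

(* The space of real symmetric N x N matrices, normed by restriction of the
   norm of 'M[R]_N; since it is finite-dimensional, the notion of derivative
   does not depend on the choice of norm. *)
Record symmx (R : realType) (N : nat) : Type := SymMx {
  mx_of_symmx :> 'M[R]_N;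
  symmxP : mx_of_symmx \is symmetricmx }.

Section SymMxInstances.
Context (R : realType) (N : nat).

HB.instance Definition _ := [isSub for @mx_of_symmx R N].
HB.instance Definition _ := [Choice of symmx R N by <:].

Let symmx_submod_closed :
  submod_closed (mem (symmetricmx : qualifier 0 'M[R]_N)).
Proof.
have memE (A : 'M[R]_N) :
    (A \in mem (symmetricmx : qualifier 0 'M[R]_N)) = (A^T == A).
  exact: symmetricmxE.
split=> [|a A B]; rewrite !memE ?trmx0//.
by rewrite linearP/= => /eqP -> /eqP ->.
Qed.

HB.instance Definition _ := GRing.SubChoice_isSubLmodule.Build
  R 'M[R]_N _ (symmx R N) symmx_submod_closed.

Let symmx_norm (A : symmx R N) : R := `|val A|.

Let symmx_ler_normD A B : symmx_norm (A + B) <= symmx_norm A + symmx_norm B.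
Proof. exact: ler_normD. Qed.

Let symmx_normrZ a A : symmx_norm (a *: A) = `|a| * symmx_norm A.
Proof. exact: normrZ. Qed.

Let symmx_normr0_eq0 A : symmx_norm A = 0 -> A = 0.
Proof. by move=> /normr0_eq0 A0; apply: val_inj. Qed.

HB.instance Definition _ := @Lmodule_isNormed.Build R (symmx R N)
  symmx_norm symmx_ler_normD symmx_normrZ symmx_normr0_eq0.

End SymMxInstances.

Section DPP.
Context (R : realType) (N : nat).
Implicit Types (A L : 'M[R]_N) (J : {set 'I_N}).

Definition posdefmx A : Prop :=
  A \is symmetricmx /\
  forall x : 'rV[R]_N, x != 0 -> 0 < (x *m A *m x^T) 0 0.

Definition principal_submx A J : 'M[R]_#|J| := mxsub enum_val enum_val A.

Definition dpp_prob L J : R := \det (principal_submx L J) / \det (1%:M + L).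

(* The log-likelihood is defined on positive definite matrices. They form an
   open subset of symmx R N, on which all the determinants below are positive,
   so that the values elsewhere (ln is 0 on nonpositive reals) are irrelevant
   for the derivative at a positive definite matrix. *)
Definition expected_loglik (Lstar L : symmx R N) : R :=
  \sum_(J : {set 'I_N}) dpp_prob Lstar J * ln (\det (principal_submx L J))
  - ln (\det (1%:M + L)).

Definition critical_point (Lstar L : symmx R N) : Prop :=
  [/\ posdefmx L,
      differentiable (expected_loglik Lstar) L &
      forall H : symmx R N, 'd (expected_loglik Lstar) L H = 0].

Definition marginal_kernel L : 'M[R]_N := L *m invmx (1%:M + L).

End DPP.

(* Main.v *)
(* Rescaling the i-th coordinate, L(t) = D_t L D_t with D_t diagonal equal to t
   at i and to 1 elsewhere, multiplies det L_J by t^2 if i is in J and leaves it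
   unchanged otherwise, while det (I + L) is the sum of all det L_J. Hence the
   expected log-likelihood along the path t |-> L(t) is, up to a constant,
   2 a ln t - ln (t^2 d1 + d0), where a is the sum of p_J(Lstar) over the J
   containing i, and d1, d0 are the sums of det L_J over the J that do and do not
   contain i. Its derivative at t = 1 is 2 (a - d1 / (d1 + d0)), and these two
   terms are the i-th diagonal entries of Kstar and K. *)
Require Import Defs.
From mathcomp Require Import all_boot all_order all_algebra all_fingroup.
From mathcomp Require Import all_classical all_reals all_analysis.
From mathcomp Require Import polyrcf.

Set Implicit Arguments.
Unset Strict Implicit.
Unset Printing Implicit Defensive.

Import Order.TTheory GRing.Theory Num.Theory.
Import numFieldNormedType.Exports.

Local Open Scope ring_scope.

(** * Expansion of determinants into principal minors *)

Lemma det_mxsub_inj (K : comNzRingType) (m n : nat) (f : 'I_m -> 'I_n)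
    (A : 'M[K]_n) :
  injective f -> m = n -> \det (mxsub f f A) = \det A.
Proof.
(* Once [m] and [n] are identified, [f] is a permutation acting on both rows and columns, so its
   sign occurs squared. The equality is a hypothesis because [#|J| + #|~: J|] equals [N] only
   propositionally. *)
move=> + mn; case: _ / mn A f => A f injf.
have -> : mxsub f f A = perm_mx (perm injf) *m (A *m (perm_mx (perm injf))^T).
  rewrite tr_perm_mx -col_permE -row_permE.
  by apply/matrixP => i j; rewrite !mxE !permE.
by rewrite !det_mulmx det_tr mulrCA -expr2 det_perm sqrr_sign mulr1.
Qed.

Section PrincipalMinors.
Context (R : realType) (N : nat).
Implicit Types (A L : 'M[R]_N) (J : {set 'I_N}) (d : 'rV[R]_N).

(** Listing the indices of [J] first and the others after them makes the matrix block upper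
    triangular: the rows outside [J] are those of [diag_mx d], so they vanish on the columns of
    [J]. *)
Lemma det_rows_diag d A J :
  \det (\matrix_(i, j) if i \in J then A i j else diag_mx d i j) =
    \det (principal_submx A J) * \prod_(i | i \notin J) d 0 i.
Proof.
pose f (k : 'I_(#|J| + #|~: J|)) : 'I_N :=
  match fintype.split k with inl a => enum_val a | inr b => enum_val b end.
have fl a : f (lshift _ a) = enum_val a by rewrite /f (unsplitK (inl a)).
have fr b : f (rshift _ b) = enum_val b by rewrite /f (unsplitK (inr b)).
have frJ b : f (rshift _ b) \notin J by have := enum_valP b; rewrite inE fr.
have flJ a : f (lshift _ a) \in J by rewrite fl enum_valP.
have injf : injective f.
  move=> k l; case: (fintype.splitP k) => a ka; case: (fintype.splitP l) => b lb.
  - have -> : k = lshift _ a by apply: val_inj.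
    have -> : l = lshift _ b by apply: val_inj.
    by rewrite !fl => /enum_val_inj ->.
  - have -> : k = lshift _ a by apply: val_inj.
    have -> : l = rshift _ b by apply: val_inj.
    by move=> e; have := frJ b; rewrite -e flJ.
  - have -> : k = rshift _ a by apply: val_inj.
    have -> : l = lshift _ b by apply: val_inj.
    by move=> e; have := frJ a; rewrite e flJ.
  - have -> : k = rshift _ a by apply: val_inj.
    have -> : l = rshift _ b by apply: val_inj.
    by rewrite !fr => /enum_val_inj ->.
have card_N : (#|J| + #|~: J|)%N = N by rewrite cardsC card_ord.
rewrite -(det_mxsub_inj _ injf card_N) -[X in \det X]submxK.
set M := mxsub f f _.
have -> : dlsubmx M = 0.
  apply/matrixP => b a; rewrite !mxE (negPf (frJ b)).
  by case: eqP => // e; have := frJ b; rewrite e flJ.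
have -> : ulsubmx M = principal_submx A J.
  by apply/matrixP => a b; rewrite !mxE flJ !fl.
have -> : drsubmx M = diag_mx (\row_b d 0 (enum_val b)).
  apply/matrixP => a b; rewrite !mxE (negPf (frJ _)) !fr.
  by rewrite (inj_eq enum_val_inj).
rewrite det_ublock det_diag; congr (_ * _).
under eq_bigr do rewrite mxE.
rewrite -(big_enum_val (fun i => d 0 i)).
by apply: eq_bigl => i; rewrite inE.
Qed.

(** Multilinearity in the rows: [J] is the set of rows taken from [A]. It is obtained by
    distributing each product in the Leibniz formula. *)
Lemma det_diagD d A :
  \det (diag_mx d + A) =
    \sum_J \det (principal_submx A J) * \prod_(i | i \notin J) d 0 i.
Proof.
under eq_bigr do rewrite -det_rows_diag.
rewrite addrC /determinant exchange_big /=; apply: eq_bigr => s _.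
rewrite -mulr_sumr; congr (_ * _).
under eq_bigr do rewrite mxE.
rewrite bigA_distr /=; apply: eq_bigr => J _; apply: eq_bigr => i _.
by rewrite [RHS]mxE.
Qed.

Lemma det_1D A : \det (1%:M + A) = \sum_J \det (principal_submx A J).
Proof.
rewrite -diag_const_mx det_diagD; apply: eq_bigr => J _.
by rewrite big1 ?mulr1// => i _; rewrite mxE.
Qed.

(** Since K = I - (I + L)^-1, the entry is 1 minus the quotient of the (i, i) cofactor of I + L by
    its determinant. *)
Lemma marginal_kernel_diag L i : \det (1%:M + L) != 0 ->
  marginal_kernel L i i =
    (\sum_(J : {set 'I_N} | i \in J) \det (principal_submx L J)) /
      \det (1%:M + L).
Proof.
move=> det0.
have unitM : 1%:M + L \in unitmx by rewrite unitmxE unitfE.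
(* A zero at [i] kills every term of [det_diagD] whose [J] misses [i]. *)
pose d : 'rV[R]_N := \row_j (j != i)%:R.
have detd : \det (diag_mx d + L) =
    \sum_(J : {set 'I_N} | i \in J) \det (principal_submx L J).
  rewrite det_diagD [RHS]big_mkcond; apply: eq_bigr => J _ /=.
  case: ifPn => iJ.
    rewrite big1 ?mulr1// => j jJ; rewrite mxE.
    by case: eqP => // e; rewrite -e (negPf jJ) in iJ.
  by rewrite (bigD1 i)//= mxE eqxx mul0r mulr0.
(* The two matrices differ only by 1 at (i, i), so their expansions along row [i] have the same
   cofactors. *)
have detE : \det (1%:M + L) = cofactor (1%:M + L) i i + \det (diag_mx d + L).
  rewrite !(expand_det_row _ i).
  have cofE j : cofactor (diag_mx d + L) i j = cofactor (1%:M + L) i j.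
    rewrite /cofactor; congr (_ * \det _); apply/matrixP => k l.
    by rewrite !mxE [lift i k == i]eq_sym (negPf (neq_lift _ _)).
  under [in RHS]eq_bigr do rewrite cofE.
  rewrite (bigD1 i)//= [in RHS](bigD1 i)//= !mxE !eqxx /= mulr1n add0r.
  rewrite addrA; congr (_ + _); first by rewrite mulrDl mul1r.
  by apply: eq_bigr => j ji; rewrite !mxE eq_sym (negPf ji).
have -> : marginal_kernel L = 1%:M - invmx (1%:M + L).
  rewrite /marginal_kernel -[X in X *m _](addKr 1%:M) mulmxDl mulmxV// mulNmx.
  by rewrite mul1mx addrC.
rewrite /invmx unitM !mxE eqxx mulr1n -detd.
apply: (mulIf det0); rewrite divfK// mulrBl mul1r mulrC mulrA mulfV// mul1r.
by rewrite detE addrC addKr.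
Qed.

End PrincipalMinors.

(** * Positivity of the determinants *)

Section PositiveDefinite.
Context (R : realType).

Lemma posdefmx_det_gt0 (N : nat) (A : 'M[R]_N) : posdefmx A -> 0 < \det A.
Proof.
move=> [_ posA].
(* char_poly (- A) is x |-> det (x I + A), which is monic and does not vanish
   for x >= 0. *)
have no_root (x : R) : 0 <= x -> ~~ root (char_poly (- A)) x.
  move=> x0; rewrite -eigenvalue_root_char; apply/eigenvalueP => -[v vA v0].
  have := posA _ v0; apply/negP; rewrite -leNgt.
  rewrite -(oppr_ge0 (_ 0 0)).
  have -> : - (v *m A *m v^T) 0 0 = (v *m - A *m v^T) 0 0.
    by rewrite mulmxN mulNmx !mxE.
  rewrite vA -scalemxAl mxE mulr_ge0// mxE sumr_ge0// => j _.
  by rewrite !mxE -expr2 sqr_ge0.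
have det_horner : (char_poly (- A)).[0] = \det A.
  by rewrite horner_coef0 char_poly_det -(scaleN1r A) detZ mulrA -exprMn mulrN1
     opprK expr1n mul1r.
(* Without roots on [0, +oo[, the polynomial has at 0 the sign it has at infinity, that of its
   leading coefficient 1. *)
rewrite -sgr_cp0 -det_horner (@sgp_pinftyP _ 0) ?in_itv/= ?lexx//.
  by rewrite /sgp_pinfty (monicP (char_poly_monic _)) sgr1.
by move=> x; rewrite in_itv /= andbT => /no_root.
Qed.

Lemma posdefmx_1D (N : nat) (A : 'M[R]_N) : posdefmx A -> posdefmx (1%:M + A).
Proof.
move=> [symA posA]; split.
  move: symA; rewrite !symmetricmxE => /eqP symA.
  by rewrite linearD /= trmx1 symA.
move=> x x0; rewrite mulmxDr mulmxDl mulmx1 mxE ltr_wpDl ?posA//.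
by rewrite mxE sumr_ge0// => j _; rewrite !mxE -expr2 sqr_ge0.
Qed.

Lemma posdefmx_principal (N : nat) (A : 'M[R]_N) (J : {set 'I_N}) :
  posdefmx A -> posdefmx (principal_submx A J).
Proof.
move=> [symA posA]; split.
  move: symA; rewrite !symmetricmxE => /eqP symA.
  by rewrite -{2}symA; apply/eqP/matrixP => i j; rewrite !mxE.
move=> x x0.
(* [x *m P] extends [x] by zeros outside [J]; [P *m P^T = 1%:M] shows that it stays nonzero. *)
pose P : 'M[R]_(#|J|, N) := rowsub enum_val 1%:M.
have PA : principal_submx A J = P *m A *m P^T.
  rewrite /P mul_rowsub_mx mul1mx.
  have -> : (rowsub enum_val 1%:M)^T =
      colsub (@enum_val _ (mem J)) 1%:M :> 'M[R]_(N, #|J|).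
    by apply/matrixP => i j; rewrite !mxE eq_sym.
  by rewrite mulmx_colsub mulmx1; apply/matrixP => i j; rewrite !mxE.
have PP : P *m P^T = 1%:M.
  apply/matrixP => i j; rewrite !mxE (bigD1 (enum_val j))//= !mxE eqxx mulr1.
  rewrite big1 ?addr0 ?(inj_eq enum_val_inj)// => k kj.
  by rewrite !mxE eq_sym [_ == k]eq_sym (negPf kj) mulr0.
have /posA : x *m P != 0.
  by apply: contra x0 => /eqP xP; rewrite -[x]mulmx1 -PP mulmxA xP mul0mx.
by rewrite PA trmx_mul !mulmxA.
Qed.

End PositiveDefinite.

(** * The path that rescales one coordinate *)

Section CoordinateScaling.
Context (R : realType) (N : nat).
Implicit Types (L : 'M[R]_N) (J : {set 'I_N}) (i : 'I_N) (t : R).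

Definition scale_coord i t L : 'M[R]_N :=
  let D := diag_mx (\row_j (if j == i then t else 1)) in D *m L *m D.

Lemma det_scale_coord i t L J :
  \det (principal_submx (scale_coord i t L) J) =
    (if i \in J then t ^+ 2 else 1) * \det (principal_submx L J).
Proof.
pose DJ : 'M[R]_#|J| :=
  diag_mx (\row_k (if enum_val k == i then t else 1)).
have -> : principal_submx (scale_coord i t L) J =
    DJ *m principal_submx L J *m DJ.
  rewrite /scale_coord /DJ !mul_diag_mx !mul_mx_diag.
  by apply/matrixP => k l; rewrite !mxE.
have detDJ : \det DJ = if i \in J then t else 1.
  rewrite det_diag; under eq_bigr do rewrite mxE.
  rewrite -(big_enum_val (fun j => if j == i then t else 1)).
  case: ifPn => iJ.
    rewrite (bigD1 i)//= eqxx big1 ?mulr1// => j /andP[_ ji].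
    by rewrite (negPf ji).
  rewrite big1// => j jJ; case: eqP => // ji.
  by move: jJ; rewrite ji (negPf iJ).
rewrite !det_mulmx detDJ mulrAC.
by case: ifP => _; rewrite ?mul1r// -expr2.
Qed.

Lemma det_1D_scale_coord i t L :
  \det (1%:M + scale_coord i t L) =
    t ^+ 2 * (\sum_(J : {set 'I_N} | i \in J) \det (principal_submx L J)) +
    \sum_(J : {set 'I_N} | i \notin J) \det (principal_submx L J).
Proof.
rewrite det_1D (bigID (fun J : {set 'I_N} => i \in J))/= mulr_sumr.
congr (_ + _); apply: eq_bigr => J; rewrite det_scale_coord.
  by move=> ->.
by move=> /negPf ->; rewrite mul1r.
Qed.

(** The path has to live in [symmx], where the likelihood is differentiated. With E the matrix unit
    at (i, i), D_t = I + (t - 1) E, so D_t L D_t is a polynomial in t - 1 with symmetric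
    coefficients. *)
Lemma scale_coord_path (L : symmx R N) i :
  exists phi : R -> symmx R N,
    [/\ phi 1 = L, forall t, phi t = scale_coord i t L :> 'M[R]_N &
        differentiable phi (1 : R)].
Proof.
have symL : (L : 'M[R]_N)^T = L.
  by apply/eqP; rewrite -symmetricmxE; exact: symmxP.
pose E : 'M[R]_N := delta_mx i i.
have trE : E^T = E by rewrite trmx_delta.
have symH : E *m L + L *m E \is symmetricmx.
  by rewrite symmetricmxE linearD/= !trmx_mul symL trE addrC.
have symC : E *m L *m E \is symmetricmx.
  by rewrite symmetricmxE !trmx_mul symL trE mulmxA.
pose phi t : symmx R N :=
  L + (t - 1) *: SymMx symH + (t - 1) ^+ 2 *: SymMx symC.
have phiE t : phi t = scale_coord i t L :> 'M[R]_N.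
  rewrite /scale_coord.
  have -> : diag_mx (\row_j (if j == i then t else 1)) = 1%:M + (t - 1) *: E.
    apply/matrixP => k l; rewrite !mxE.
    have [->|kl] := eqVneq k l; last first.
      have [ki|] := eqVneq k i; last by rewrite mulr0 addr0.
      by rewrite -ki [_ == k]eq_sym (negPf kl) mulr0 addr0.
    by case: eqVneq => _; rewrite ?mulr1 ?mulr0 ?addr0 // addrC subrK.
  rewrite mulmxDl mul1mx mulmxDr mulmx1 mulmxDl -!scalemxAl -!scalemxAr.
  rewrite scalerA -expr2 /phi /= !addrA; congr (_ + _).
  by rewrite -!addrA -scalerDr.
exists phi; split; [|exact: phiE|].
  by rewrite /phi subrr expr0n/= !scale0r !addr0.
have diffB1 : differentiable (fun t : R => t - 1) (1 : R).
  exact/derivable1_diffP.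
have diffB1X2 : differentiable (fun t : R => (t - 1) ^+ 2) (1 : R).
  exact/derivable1_diffP.
apply: (@differentiableD _ _ _ (fun t => L + (t - 1) *: SymMx symH)).
  apply: (@differentiableD _ _ _ (fun t => L : symmx R N)).
    exact: differentiable_cst.
  exact: (differentiableZl _ diffB1).
exact: (differentiableZl _ diffB1X2).
Qed.

End CoordinateScaling.

(** * Differentiation along the path at a critical point *)

Theorem proposition13 (R : realType) (N : nat) (Lstar L : symmx R N) :
  posdefmx Lstar ->
  critical_point Lstar L ->
  forall i : 'I_N, marginal_kernel Lstar i i = marginal_kernel L i i.
Proof.
move=> posLs [posL diffL critL] i.
have detLs_gt0 : 0 < \det (1%:M + Lstar).
  exact/posdefmx_det_gt0/posdefmx_1D.
have detL_gt0 : 0 < \det (1%:M + L).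
  exact/posdefmx_det_gt0/posdefmx_1D.
have minor_gt0 J : 0 < \det (principal_submx L J).
  exact/posdefmx_det_gt0/posdefmx_principal.
have [phi [phi1 phiE diff_phi]] := scale_coord_path L i.
(* By the chain rule, this is the differential at [L], which vanishes, applied to the velocity of
   the path. *)
have deriv0 : 'D_1 (expected_loglik Lstar \o phi) (1 : R) = 0.
  rewrite deriveE; last by apply: differentiable_comp; rewrite ?phi1.
  by rewrite diff_comp ?phi1 //= critL.
rewrite !marginal_kernel_diag ?lt0r_neq0//.
set d1 := \sum_(J : {set 'I_N} | i \in J) \det (principal_submx L J).
pose d0 := \sum_(J : {set 'I_N} | i \notin J) \det (principal_submx L J).
have d01 : d1 + d0 = \det (1%:M + L).
  by rewrite det_1D (bigID (fun J : {set 'I_N} => i \in J)).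
pose p := dpp_prob Lstar.
pose c := \sum_J p J * ln (\det (principal_submx L J)).
pose a := \sum_(J : {set 'I_N} | i \in J) p J.
have -> : (\sum_(J : {set 'I_N} | i \in J) \det (principal_submx Lstar J))
   / \det (1%:M + Lstar) = a by rewrite mulr_suml.
have pathE (t : R) : 0 < t -> c + 2 * a * ln t - ln (t ^+ 2 * d1 + d0) =
    expected_loglik Lstar (phi t).
  move=> t0; rewrite /expected_loglik !phiE det_1D_scale_coord -/d1 -/d0.
  congr (_ - _).
  rewrite /a mulr_sumr mulr_suml big_mkcond /= /c -big_split /=.
  apply: eq_bigr => J _; rewrite det_scale_coord.
  case: ifP => _; last by rewrite mul1r addr0.
  rewrite lnM ?posrE ?exprn_gt0// lnXn// mulrDr addrC; congr (_ + _).
  by rewrite mulr_natl mulrnAl mulrnAr.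
have deriv : is_derive (1 : R) 1
    (fun t => c + 2 * a * ln t - ln (t ^+ 2 * d1 + d0))
    (2 * a - (d1 + d0)^-1 * (2 * d1)).
  have ln' : is_derive ((1 : R) ^+ 2 * d1 + d0) 1 (@ln R) (d1 + d0)^-1.
    by rewrite expr1n mul1r; apply: is_derive1_ln; rewrite d01.
  have ln1' : is_derive (1 : R) 1 (@ln R) 1^-1 by exact: is_derive1_ln.
  have quad' : is_derive (1 : R) 1 (fun t : R => t ^+ 2 * d1 + d0) (2 * d1).
    apply: is_derive_eq.
    by rewrite /GRing.scale /= mulr0 add0r addr0 mulr1 mulrC.
  have comp' := @is_derive1_comp _ (@ln R) (fun t => t ^+ 2 * d1 + d0) _ _ _
    ln' quad'.
  have lin' : is_derive (1 : R) 1 (fun t => c + 2 * a * ln t) (2 * a).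
    apply: is_derive_eq.
    by rewrite add0r mul1r invr1 /GRing.scale /= mulr1.
  exact: is_deriveB.
have : 2 * a - (d1 + d0)^-1 * (2 * d1) = 0.
  rewrite -deriv0 -(@derive_val _ _ _ _ _ _ _ deriv).
  (* The closed form is established for t > 0, a neighbourhood of 1, which determines the derivative
     there. *)
  by apply: near_eq_derive; apply: filterS (lt_nbhsr ltr01) => t /pathE.
rewrite d01 mulrCA -mulrBr => /eqP; rewrite mulf_eq0 pnatr_eq0 /= subr_eq0.
by move=> /eqP ->; rewrite mulrC.
Qed.
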